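(* Let $G$ be a finite simple connected graph with $|E(G)|>\nu_2(G)$ and $\nu_2(G)\ge 5$. Then $\gamma(G)=\nu_2(G)-1$ if and only if $G$ is isomorphic to $T^{\nu_2(G)}_{s,t}$ for some positive integers $s,t$ with $s+4=\nu_2(G)$.
   Context: A 2-packing of a graph $G$ is a set $R\subseteq E(G)$ such that no three edges of $R$ are incident with a common vertex; $\nu_2(G)$ is the maximum size of a 2-packing. $\gamma(G)$ is the domination number: the minimum size of a set $D\subseteq V(G)$ such that every vertex is in $D$ or adjacent to a vertex of $D$. For positive integers $s,t$ and $r=s+4$, $T^{r}_{s,t}$ is the tree with vertex set $\{v_0,\ldots,v_4\}\cup\{p_1,\ldots,p_s\}\cup\{q_1,\ldots,q_s\}\cup\{w_1,\ldots,w_t\}$ (all distinct) and edge set $\{v_0v_1,v_1v_2,v_2v_3,v_3v_4\}\cup\{p_iq_i:1\le i\le s\}\cup\{v_2w_i:1\le i\le t\}\cup\{v_2p_i:1\le i\le s\}$. *)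

(* Defs.v *)
From mathcomp Require Import all_boot.

Set Implicit Arguments.
Unset Strict Implicit.
Unset Printing Implicit Defensive.

Record sgraph := SGraph {
  vertex :> finType;
  adj : rel vertex;
  adj_sym : symmetric adj;
  adj_irrefl : irreflexive adj
}.

Definition edges (G : sgraph) : {set {set G}} :=
  [set [set p.1; p.2] | p : G * G & adj p.1 p.2].

Definition connected (G : sgraph) : Prop :=
  forall x y : G, connect (@adj G) x y.

Definition two_packing (G : sgraph) (R : {set {set G}}) : bool :=
  (R \subset edges G) && [forall v : G, #|[set f in R | v \in f]| <= 2].

Definition nu2 (G : sgraph) : nat :=
  \max_(R : {set {set G}} | two_packing R) #|R|.

Definition dominating (G : sgraph) (D : {set G}) : bool :=
  [forall v : G, (v \in D) || [exists u in D, adj v u]].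

(* [set: G] is always dominating, so the minimum is over a nonempty family. *)
Definition gamma (G : sgraph) : nat :=
  #|[arg min_(D < [set: G] | dominating D) #|D|]|.

Definition isomorphic (G H : sgraph) : Prop :=
  exists2 f : G -> H, bijective f & forall x y : G, adj (f x) (f y) = adj x y.

Definition Tvertex (s t : nat) : finType := ('I_5 + 'I_s + 'I_s + 'I_t)%type.

Notation Tv i := (inl (inl (inl i))).
Notation Tp i := (inl (inl (inr i))).
Notation Tq i := (inl (inr i)).
Notation Tw i := (inr i).

(* Each edge is listed in one direction only; Tadj symmetrizes. *)
Definition Tarc (s t : nat) (x y : Tvertex s t) : bool :=
  match x, y with
  | Tv i, Tv j => nat_of_ord j == i.+1
  | Tp i, Tq j => i == j
  | Tv i, Tw _ => nat_of_ord i == 2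
  | Tv i, Tp _ => nat_of_ord i == 2
  | _, _ => false
  end.

Definition Tadj (s t : nat) : rel (Tvertex s t) :=
  fun x y => Tarc x y || Tarc y x.

Lemma Tadj_sym (s t : nat) : symmetric (@Tadj s t).
Proof. by move=> x y; rewrite /Tadj orbC. Qed.

Lemma Tadj_irrefl (s t : nat) : irreflexive (@Tadj s t).
Proof.
by move=> [[[i|i]|i]|i] //=; rewrite /Tadj /= orbb; apply/negbTE; rewrite neq_ltn ltnSn.
Qed.

(* T^r_{s,t} with r = s + 4. *)
Definition T (s t : nat) : sgraph := SGraph (@Tadj_sym s t) (@Tadj_irrefl s t).

(* Main.v *)
Require Import Defs.
From mathcomp Require Import all_boot.

(* Suppose gamma = nu_2 - 1.  Some minimum dominating set D assigns to every
   x in D a private neighbour m x outside D (Bollobas-Cockayne), so the edges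
   {x, m x} form a matching M of size gamma.  Adding two disjoint edges to M
   gives a 2-packing of size gamma + 2 > nu_2; hence the edges outside M
   pairwise intersect, and since M has at least four edges, each of which is
   touched by one outside M by connectedness, they form a star with centre c.
   If M missed c, two star edges could still be added to M; so c is covered by
   M.  Privateness of the neighbours m x forbids c from being adjacent to both
   ends of another edge of M, which leaves only the trees T_{s,t}. *)

Set Implicit Arguments.
Unset Strict Implicit.
Unset Printing Implicit Defensive.

(** * Domination and its invariance under isomorphism *)

Lemma adj_neq (G : sgraph) (x y : G) : adj x y -> x != y.
Proof. by move=> xy; apply/eqP => e; rewrite e adj_irrefl in xy. Qed.

Lemma dominatingP (G : sgraph) (D : {set G}) :
  reflect (forall v, v \notin D -> exists2 u, u \in D & adj v u)
          (dominating D).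
Proof.
apply: (iffP forallP) => [h v vD | h v].
  by have := h v; rewrite (negbTE vD) /= => /existsP[u /andP[]]; exists u.
case vD: (v \in D) => //=.
by have [u uD vu] := h v (negbT vD); apply/existsP; exists u; rewrite uD.
Qed.

Lemma dominating_setT (G : sgraph) : dominating [set: G].
Proof. by apply/dominatingP => v; rewrite in_setT. Qed.

Lemma gamma_leq (G : sgraph) (D : {set G}) : dominating D -> gamma G <= #|D|.
Proof.
move=> dD; rewrite /gamma.
by case: arg_minnP => [|i _]; [exact: dominating_setT | apply].
Qed.

Lemma gamma_attained (G : sgraph) :
  exists2 D : {set G}, dominating D & #|D| = gamma G.
Proof.
rewrite /gamma; case: arg_minnP => [|D dD _]; first exact: dominating_setT.
by exists D.
Qed.

Lemma gamma_iso_leq (G H : sgraph) : isomorphic G H -> gamma H <= gamma G.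
Proof.
case=> f [g fK gK] fadj; have [D /dominatingP dD <-] := gamma_attained G.
rewrite -(card_imset (mem D) (can_inj fK)); apply: gamma_leq.
apply/dominatingP => v; rewrite -[v]gK mem_imset; last exact: can_inj fK.
move=> /dD[u uD vu]; exists (f u); first exact: imset_f.
by rewrite fadj.
Qed.

Lemma isomorphic_sym (G H : sgraph) : isomorphic G H -> isomorphic H G.
Proof.
case=> f [g fK gK] fadj; exists g; first by exists f.
by move=> x y; rewrite -fadj !gK.
Qed.

Lemma gamma_iso (G H : sgraph) : isomorphic G H -> gamma G = gamma H.
Proof.
move=> GH; apply/eqP; rewrite eqn_leq !gamma_iso_leq //.
exact: isomorphic_sym.
Qed.

(** * The domination number of the trees [T s t] *)

(** Splits the tree into [s + 3] fibres: [{v_0, v_1}], [{v_3, v_4}], [v_2] with all [w_j], and each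
    [{p_i, q_i}]. *)
Definition Tleg_rep (s t : nat) (x : T s t) : 'I_3 + 'I_s :=
  match x with
  | Tv i => inl (if i < 2 then inord 0 else if 2 < i then inord 1 else inord 2)
  | Tp i | Tq i => inr i
  | Tw _ => inl (inord 2)
  end.

(** A section of [Tleg_rep] choosing [v_0], [v_4], [v_2] and the [q_i], which together dominate the
    tree. *)
Definition Trep (s t : nat) (z : 'I_3 + 'I_s) : T s t :=
  match z with
  | inl i => Tv (inord (if i == 0 :> nat then 0 else if i == 1 :> nat then 4 else 2))
  | inr i => Tq i
  end.

Lemma TrepK (s t : nat) : cancel (@Trep s t) (@Tleg_rep s t).
Proof.
case=> [[[|[|[|//]]] ?]|//] /=; rewrite inordK //=; congr inl;
by apply: val_inj; rewrite /= inordK.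
Qed.

Lemma Trep_dominating (s t : nat) :
  dominating [set @Trep s t z | z in [set: 'I_3 + 'I_s]].
Proof.
apply/dominatingP => v vD.
have repD z : Trep t z \in [set Trep t z | z in [set: 'I_3 + 'I_s]].
  exact: imset_f.
have tv (k : 'I_3) (i : 'I_5) :
    i = (if k == 0 :> nat then 0 else if k == 1 :> nat then 4 else 2) :> nat ->
    (Tv i : T s t) \in [set Trep t z | z in [set: 'I_3 + 'I_s]].
  move=> e; suff -> : (Tv i : T s t) = Trep t (inl k) by [].
  congr (inl (inl (inl _))).
  by apply: val_inj; rewrite /= e inordK //; case: ifP => // _; case: ifP.
case: v vD => [[[i|i]|i]|i] vD.
- case: i vD => [[|[|[|[|[|//]]]]] lti] vD.
  + by case/negP: vD; apply: (tv (@Ordinal 3 0 isT)).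
  + by exists (Tv (@Ordinal 5 0 isT)) => //; apply: (tv (@Ordinal 3 0 isT)).
  + by case/negP: vD; apply: (tv (@Ordinal 3 2 isT)).
  + by exists (Tv (@Ordinal 5 4 isT)) => //; apply: (tv (@Ordinal 3 1 isT)).
  + by case/negP: vD; apply: (tv (@Ordinal 3 1 isT)).
- exists (Tq i); first exact: repD (inr i).
  by rewrite /= /Tadj /= eqxx.
- by case/negP: vD; apply: repD (inr i).
- by exists (Tv (@Ordinal 5 2 isT)) => //; apply: (tv (@Ordinal 3 2 isT)).
Qed.

(* The closed neighbourhoods of v_0, v_4, w_j and the q_i are pairwise
   disjoint, so every dominating set meets all s + 3 fibres of Tleg_rep. *)
Lemma Tleg_rep_dominating (s t : nat) (D : {set T s t}) :
  0 < t -> dominating D -> [set Tleg_rep x | x in D] = [set: 'I_3 + 'I_s].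
Proof.
move=> t_gt0 /dominatingP dD; apply/setP => z; rewrite in_setT.
suff [v vz vadj] : exists2 v : T s t, Tleg_rep v = z &
    forall u, adj v u -> Tleg_rep u = z.
  have [vD|/dD[u uD /vadj uz]] := boolP (v \in D); apply/imsetP.
    by exists v.
  by exists u.
case: z => [[[|[|[|//]]] lti]|i].
- exists (Tv (@Ordinal 5 0 isT)); last first.
    move=> [[[[[|[|[|[|[|//]]]]] ltj]|j]|j]|j] //= _.
    by congr inl; apply: val_inj; rewrite /= inordK.
  by congr inl; apply: val_inj; rewrite /= inordK.
- exists (Tv (@Ordinal 5 4 isT)); last first.
    move=> [[[[[|[|[|[|[|//]]]]] ltj]|j]|j]|j] //= _.
    by congr inl; apply: val_inj; rewrite /= inordK.
  by congr inl; apply: val_inj; rewrite /= inordK.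
(* [v_2] has neighbours in other fibres, so a leaf must serve here; [0 < t] provides it. *)
- exists (Tw (Ordinal t_gt0)); last first.
    move=> [[[[[|[|[|[|[|//]]]]] ltj]|j]|j]|j] //= _.
    by congr inl; apply: val_inj; rewrite /= inordK.
  by congr inl; apply: val_inj; rewrite /= inordK.
- exists (Tq i) => //; move=> [[[j|j]|j]|j] //=.
  by rewrite /Tadj /= => /eqP->.
Qed.

Lemma gamma_T (s t : nat) : 0 < t -> gamma (T s t) = s + 3.
Proof.
move=> t_gt0.
have card_idx : s + 3 = #|[set: 'I_3 + 'I_s]|.
  by rewrite cardsT card_sum !card_ord addnC.
apply/eqP; rewrite eqn_leq card_idx; apply/andP; split.
  rewrite -(card_imset _ (can_inj (@TrepK s t))).
  exact: gamma_leq (Trep_dominating s t).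
have [D dD <-] := gamma_attained (T s t).
by rewrite -(Tleg_rep_dominating t_gt0 dD) leq_imset_card.
Qed.

(** * Private neighbours outside a minimum dominating set *)

(** External private neighbours as a total function; only its values on [D] are constrained. *)
Definition private_neighbors (G : sgraph) (D : {set G}) (m : G -> G) :=
  forall x, x \in D ->
    [/\ m x \notin D, adj x (m x) & forall z, z \in D -> adj z (m x) -> z = x].

(* Among the minimum dominating sets take one with fewest isolated vertices: an
   isolated x without private neighbour could be exchanged for a neighbour. *)
Lemma private_neighbors_exist (G : sgraph) :
  (forall x : G, exists y, adj x y) ->
  exists D m, [/\ dominating D, #|D| = gamma G & @private_neighbors G D m].
Proof.
move=> noiso.
pose iso (D : {set G}) := [set x in D | [forall u in D, ~~ adj x u]].
have [D0 dD0 cD0] := gamma_attained G.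
pose P (D : {set G}) := dominating D && (#|D| == gamma G).
have PD0 : P D0 by rewrite /P dD0 cD0 eqxx.
have [D /andP[dD /eqP cD] minD] := arg_minnP (fun D => #|iso D|) PD0.
pose Q x y := [&& y \notin D, adj x y & [forall z in D, adj z y ==> (z == x)]].
suff ex x : x \in D -> exists y, Q x y.
  exists D, (fun x => odflt x [pick y | Q x y]); split=> // x /ex[y Qy].
  case: pickP => [z /and3P[zD xz /forall_inP pz]|/(_ y)]; last by rewrite Qy.
  by split=> //= u uD uz; have /implyP/(_ uz)/eqP := pz u uD.
move=> xD; apply/existsP; apply: contraT => /existsPn nQ.
have dom_other y : y \notin D -> adj x y -> exists2 z, z \in D :\ x & adj z y.
  move=> yD xy; have := nQ y; rewrite /Q yD xy /= => /forall_inPn[z zD].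
  by rewrite negb_imply => /andP[zy zx]; exists z; rewrite // !inE zx.
(* As [x] has no private neighbour, [D :\ x] still dominates every vertex except possibly [x]. *)
have domD y : y != x -> y \notin D :\ x -> exists2 z, z \in D :\ x & adj y z.
  move=> yx; rewrite !inE yx /= => yD.
  have /dominatingP/(_ y yD)[u uD yu] := dD.
  have [eux|ux] := eqVneq u x; last by exists u; rewrite // !inE ux.
  have [|z zD zy] := dom_other y yD; first by rewrite -eux adj_sym.
  by exists z; rewrite // adj_sym.
have x_iso u : u \in D -> ~~ adj x u.
  move=> uD; apply/negP => xu.
  suff : dominating (D :\ x).
    by move=> /gamma_leq; rewrite -cD (cardsD1 x D) xD add1n ltnn.
  apply/dominatingP => y yD; have [->|yx] := eqVneq y x; last exact: domD.
  by exists u; rewrite // !inE uD andbT eq_sym adj_neq.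
have [y xy] := noiso x.
have yD : y \notin D by apply: contraL xy; apply: x_iso.
have [z zD zy] := dom_other y yD xy.
(* Exchanging [x] for [y] keeps the size. The isolated [x] is lost, [y] has the neighbour [z], and
   no other vertex becomes isolated because [x] had no neighbour in [D]. *)
pose D' := y |: D :\ x.
have PD' : P D'.
  rewrite /P cardsU1 !inE (negbTE yD) andbF /=.
  rewrite -cD (cardsD1 x D) xD eqxx andbT.
  apply/dominatingP => v; rewrite in_setU1 negb_or => /andP[vy vD].
  have [->|vx] := eqVneq v x; first by exists y; rewrite // setU11.
  by have [u uD vu] := domD v vx vD; exists u; rewrite // setU1r.
have := minD _ PD'; rewrite leqNgt => /negP[].
apply: proper_card; apply/properP; split; last first.
  exists x; first by rewrite inE xD; apply/forall_inP.
  by rewrite !inE eqxx /= orbF (negbTE (adj_neq xy)).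
apply/subsetP => u; rewrite [in X in X -> _]inE => /andP[].
rewrite in_setU1 => /orP[/eqP-> /forall_inP/(_ z)|].
  by rewrite adj_sym zy setU1r // => /(_ isT).
rewrite !inE => /andP[ux uD] /forall_inP iu; rewrite uD /=.
apply/forall_inP => v vD; have [->|vx] := eqVneq v x.
  by rewrite adj_sym x_iso.
by apply: iu; rewrite !inE vx vD orbT.
Qed.

(** * Extending a matching to a 2-packing, and intersecting edges *)

Lemma edgeP (G : sgraph) (x y : G) : adj x y -> [set x; y] \in edges G.
Proof. by move=> xy; apply/imsetP; exists (x, y); rewrite ?inE. Qed.

(** A vertex meets at most one edge of [M], and none if it lies on both [f1] and [f2], so adding
    both edges keeps all degrees at most 2. *)
Lemma matching_add2_leq_nu2 (G : sgraph) (M : {set {set G}}) (f1 f2 : {set G}) :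
  M \subset edges G ->
  (forall v e f, e \in M -> f \in M -> v \in e -> v \in f -> e = f) ->
  f1 \in edges G :\: M -> f2 \in edges G :\: M -> f1 != f2 ->
  (forall v, v \in f1 -> v \in f2 -> forall e, e \in M -> v \notin e) ->
  #|M| + 2 <= nu2 G.
Proof.
move=> ME Mmatch /setDP[f1E f1M] /setDP[f2E f2M] f12 hv.
have -> : #|M| + 2 = #|f1 |: (f2 |: M)|.
  by rewrite !cardsU1 !inE (negbTE f12) (negbTE f1M) (negbTE f2M) /= addnC.
apply: (@leq_bigmax_cond _ _ (fun R : {set {set G}} => #|R|)).
rewrite /two_packing !subUset !sub1set f1E f2E ME /=; apply/forallP => v.
have M1 : #|[set f in M | v \in f]| <= 1.
  apply/card_le1_eqP => e f; rewrite !inE => /andP[eM ve] /andP[fM vf].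
  exact: (Mmatch v).
have split_card : #|[set f in f1 |: (f2 |: M) | v \in f]|
    <= (v \in f1) + ((v \in f2) + #|[set f in M | v \in f]|).
  have single (f : {set G}) : #|[set e : {set G} in [set f] | v \in e]| = (v \in f) :> nat.
    rewrite (_ : [set e : {set G} in _ | _] = if v \in f then [set f] else set0).
      by case: ifP; rewrite ?cards1 ?cards0.
    apply/setP => e; case: ifP => vf; rewrite !inE.
      by case: eqP => // ->.
    by case: eqP => // ->; rewrite vf.
  rewrite -!single.
  have -> : [set f in f1 |: (f2 |: M) | v \in f] = [set e : {set G} in [set f1] | v \in e]
      :|: ([set e : {set G} in [set f2] | v \in e] :|: [set f in M | v \in f]).
    by apply/setP => e; rewrite !inE !andb_orl.
  apply: leq_trans (leq_card_setU _ _) _.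
  by rewrite leq_add2l; apply: leq_card_setU.
apply: leq_trans split_card _.
case v1: (v \in f1); case v2: (v \in f2) => //=; rewrite ?add0n //.
- rewrite (_ : [set f in M | v \in f] = set0) ?cards0 //.
  apply/setP => e; rewrite !inE; apply/negbTE; rewrite negb_and.
  by case eM: (e \in M); rewrite //= (hv v).
- exact: leqW.
Qed.

(** Pairwise intersecting edges form a star or a triangle, and the three vertices of a triangle
    cannot touch four disjoint blocks [S x]. *)
Lemma intersecting_star (G : sgraph) (F : rel G) (D : {set G})
    (S : G -> {set G}) :
  irreflexive F ->
  (forall a b u v, F a b -> F u v -> [|| a == u, a == v, b == u | b == v]) ->
  (forall x z v, x \in D -> z \in D -> v \in S x -> v \in S z -> x = z) ->
  (forall x, x \in D -> exists u v, u \in S x /\ F u v) ->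
  4 <= #|D| ->
  exists c, forall u v, F u v -> u = c \/ v = c.
Proof.
move=> Firr Fint Sdisj touch cD.
have /card_gt0P[x0 x0D] : 0 < #|D| by apply: leq_trans cD.
have [a [b [_ ab]]] := touch x0 x0D.
pose B v := [set x in D | v \in S x].
have B1 v : #|B v| <= 1.
  apply/card_le1_eqP => x z; rewrite !inE => /andP[xD vx] /andP[zD vz].
  exact: (Sdisj _ _ v).
(* Each of [a] and [b] lies in at most one block, so two of the four blocks avoid both. *)
have /card_gt1P[x1 [x2 [x1D x2D x12]]] : 1 < #|D :\: (B a :|: B b)|.
  rewrite cardsD ltn_subRL; apply: leq_trans cD.
  rewrite addn1 !ltnS; apply: leq_trans (subset_leq_card (subsetIr _ _)) _.
  by apply: leq_trans (leq_card_setU _ _) (leq_add (B1 a) (B1 b)).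
have touch' x : x \in D :\: (B a :|: B b) ->
    exists u v, [/\ u \in S x, F u v, u != a, u != b & v == a \/ v == b].
  rewrite !inE => /andP[]; rewrite negb_or => /andP[xa xb] xD.
  rewrite xD /= in xa xb; have [u [v [ux uv]]] := touch x xD.
  have ua : u != a by apply: contraNneq xa => <-.
  have ub : u != b by apply: contraNneq xb => <-.
  exists u, v; split=> //; apply/orP; have := Fint _ _ _ _ uv ab.
  by rewrite (negbTE ua) (negbTE ub).
have [u1 [v1 [u1x uv1 u1a u1b v1ab]]] := touch' x1 x1D.
have [u2 [v2 [u2x uv2 u2a u2b v2ab]]] := touch' x2 x2D.
have u12 : u1 != u2.
  apply: contraNneq x12 => e; move: x1D x2D => /setDP[x1D _] /setDP[x2D _].
  by apply/eqP; apply: (Sdisj _ _ u1); rewrite // e.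
have v12 : v1 = v2.
  apply/eqP; have := Fint _ _ _ _ uv1 uv2; rewrite (negbTE u12) /= => /or3P[] //.
    by case: v2ab => /eqP-> /eqP e; rewrite e eqxx in u1a u1b.
  by case: v1ab => /eqP-> /eqP e; rewrite e eqxx in u2a u2b.
exists v1 => g h gh; suff : (v1 == g) || (v1 == h) by case/orP => /eqP->; [left | right].
(* An edge [gh] missing [v1] would have to be [u1 u2], which is disjoint from [ab]. *)
apply: contraT; rewrite negb_or => /andP[/negbTE v1g /negbTE v1h].
have := Fint _ _ _ _ uv1 gh; rewrite v1g v1h !orbF => u1gh.
have := Fint _ _ _ _ uv2 gh; rewrite -v12 v1g v1h !orbF => u2gh.
have notin_gh x : x != u1 -> x != u2 -> (x == g = false) * (x == h = false).
  case/orP: u1gh u2gh u12 => /eqP-> /orP[] /eqP->; rewrite ?eqxx //;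
  by move=> _ /negbTE-> /negbTE->.
have := Fint _ _ _ _ ab gh.
by rewrite !notin_gh // eq_sym.
Qed.

(** * Recognizing a spider *)

(* c is the body of the spider, e i and o i are the inner and outer vertices of
   its legs of length 2, and w j are its leaves at distance 1 from c. *)
Lemma spider_iso (G : sgraph) (s t : nat) (c : G)
    (e o : 'I_s.+2 -> G) (w : 'I_t -> G) :
  injective e -> injective o -> injective w ->
  (forall i, o i != c) -> (forall i j, e i != o j) ->
  (forall i j, e i != w j) -> (forall i j, o i != w j) ->
  #|G| <= 1 + s.+2 + s.+2 + t ->
  (forall i, adj c (e i)) -> (forall i, ~~ adj c (o i)) ->
  (forall i, adj (e i) (o i)) -> (forall j, adj c (w j)) ->
  (forall u v, adj u v -> u != c -> v != c ->
     exists i, (u = e i /\ v = o i) \/ (u = o i /\ v = e i)) ->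
  isomorphic G (T s t).
Proof.
move=> e_inj o_inj w_inj oc eo ew ow cG ce co eo_adj cw only.
(* Legs 0 and 1 become the arms [v_1 v_0] and [v_3 v_4], the other [s] legs become the [p_i q_i]. *)
pose l1 : 'I_s.+2 := lift ord0 ord0.
pose l2 (i : 'I_s) : 'I_s.+2 := lift ord0 (lift ord0 i).
pose f (x : T s t) : G := match x with
  | Tv i => match nat_of_ord i with
            0 => o ord0 | 1 => e ord0 | 2 => c | 3 => e l1 | _ => o l1 end
  | Tp i => e (l2 i)
  | Tq i => o (l2 i)
  | Tw j => w j
  end.
have ec i : e i != c by rewrite eq_sym adj_neq.
have wc j : w j != c by rewrite eq_sym adj_neq.
(* Distinctness, and later adjacency, is bundled into rewrite rules that settle the case analyses
   over pairs of vertices. *)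
have neqs := ((fun i => negbTE (ec i), fun i => negbTE (oc i), fun j => negbTE (wc j)),
  (fun i j => negbTE (eo i j), fun i j => negbTE (ew i j), fun i j => negbTE (ow i j))).
have neqs' : ((forall i, (c == e i) = false) * (forall i, (c == o i) = false)
    * (forall j, (c == w j) = false)) * ((forall i j, (o j == e i) = false)
    * (forall i j, (w j == e i) = false) * (forall i j, (w j == o i) = false)).
  by do !split=> *; rewrite eq_sym neqs.
have eqs := (inj_eq e_inj, inj_eq o_inj, inj_eq w_inj).
have adjF u v : u != c -> v != c ->
    (forall i, ~~ ((u == e i) && (v == o i))) ->
    (forall i, ~~ ((u == o i) && (v == e i))) -> adj u v = false.
  move=> uc vc h1 h2; apply/negP => /only/(_ uc vc)[i [[eu ev]|[eu ev]]].
    by have := h1 i; rewrite eu ev !eqxx.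
  by have := h2 i; rewrite eu ev !eqxx.
have ee i j : adj (e i) (e j) = false.
  by apply: adjF => // k; rewrite !neqs ?andbF.
have oo i j : adj (o i) (o j) = false.
  by apply: adjF => // k; rewrite !neqs' ?andbF.
have ww i j : adj (w i) (w j) = false.
  by apply: adjF => // k; rewrite !neqs'.
have ewF i j : adj (e i) (w j) = false.
  by apply: adjF => // k; rewrite !neqs' ?andbF.
have owF i j : adj (o i) (w j) = false.
  by apply: adjF => // k; rewrite !neqs' ?andbF.
have eoE i j : adj (e i) (o j) = (i == j).
  have [<-|ij] := eqVneq i j; first exact: eo_adj.
  apply: adjF => // k; rewrite ?neqs // !eqs.
  by apply: contra ij => /andP[/eqP-> /eqP->].
have coF i : adj c (o i) = false by apply: negbTE.
have adjs := (ee, oo, ww, ewF, owF, eoE, coF, ce, cw, adj_irrefl).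
have f_inj : injective f.
  move=> x y fxy; have {fxy} : f x == f y by rewrite fxy.
  case: x => [[[[[|[|[|[|[|//]]]]] ?]|?]|?]|?];
  case: y => [[[[[|[|[|[|[|//]]]]] ?]|?]|?]|?]; rewrite /f /=;
  rewrite ?neqs ?neqs' ?eqs -?val_eqE //= ?eqSS;
  do ?[by move=> _; do 3 congr inl; apply: val_inj];
  by move=> /eqP/val_inj->.
have cT : #|T s t| = 5 + s + s + t by rewrite !card_sum !card_ord.
have f_bij : bijective f.
  apply: inj_card_bij f_inj _; apply: leq_trans cG _.
  by rewrite cT !(addSn, addnS, add0n).
apply: isomorphic_sym; exists f => // x y.
have sadj : adj x y = Tadj x y by [].
rewrite sadj /Tadj.
case: x {sadj} => [[[[[|[|[|[|[|//]]]]] ?]|?]|?]|?];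
case: y => [[[[[|[|[|[|[|//]]]]] ?]|?]|?]|?];
rewrite /f /= ?adjs // 1?adj_sym ?adjs // -?val_eqE /= ?eqSS ?orbF // 1?eq_sym.
Qed.

(** * Private pairs as legs of a spider *)

Lemma private_neighbors_inj (G : sgraph) (D : {set G}) (m : G -> G) :
  private_neighbors D m -> {in D &, injective m}.
Proof.
move=> pm x z xD zD e; have [_ _ p] := pm z zD.
by apply: p => //; rewrite -e; case: (pm x xD).
Qed.

(** [m] takes [D] injectively into its complement, which keeps the pairs apart. *)
Lemma private_pair_inj (G : sgraph) (D : {set G}) (m : G -> G) (x z v : G) :
  private_neighbors D m -> x \in D -> z \in D ->
  v \in [set x; m x] -> v \in [set z; m z] -> x = z.
Proof.
move=> pm xD zD; rewrite !inE.
have [mxD _ _] := pm x xD; have [mzD _ _] := pm z zD.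
case/orP=> /eqP-> /orP[] /eqP e //.
- by rewrite -e xD in mzD.
- by rewrite e zD in mxD.
- exact: private_neighbors_inj pm _ _ xD zD e.
Qed.

(** Legs are indexed by a vertex set and the leaves are all remaining vertices, [y] being one of
    them. [inn] and [out] leave open which end of a matching edge is the inner one, since both
    orientations occur. *)
Lemma spider_iso_in (G : sgraph) (A : {set G}) (c y : G) (inn out : G -> G)
    (s : nat) :
  #|A| = s.+2 ->
  {in A &, injective inn} -> {in A &, injective out} ->
  {in A, forall x, out x != c} -> {in A &, forall x z, inn x != out z} ->
  y != c -> {in A, forall x, y != inn x} -> {in A, forall x, y != out x} ->
  {in A, forall x, adj c (inn x)} -> {in A, forall x, ~~ adj c (out x)} ->
  {in A, forall x, adj (inn x) (out x)} ->
  (forall v, v != c -> {in A, forall x, v != inn x} ->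
     {in A, forall x, v != out x} -> adj c v) ->
  (forall u v, adj u v -> u != c -> v != c -> exists2 x, x \in A &
     (u = inn x /\ v = out x) \/ (u = out x /\ v = inn x)) ->
  exists2 t, 0 < t & isomorphic G (T s t).
Proof.
move=> cA inn_inj out_inj out_c inn_out yc yinn yout c_inn c_out adj_io c_leaf only.
pose X := c |: (inn @: A :|: out @: A); pose W := ~: X.
have WP v : reflect [/\ v != c, {in A, forall x, v != inn x}
    & {in A, forall x, v != out x}] (v \in W).
  rewrite !inE !negb_or; apply: (iffP and3P) => [[vc vi vo]|[vc vi vo]]; split=> //.
  - by move=> x xA; apply: contraNneq vi => ->; apply: imset_f.
  - by move=> x xA; apply: contraNneq vo => ->; apply: imset_f.
  - by apply/imsetP => -[x /vi] /negP h /eqP.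
  - by apply/imsetP => -[x /vo] /negP h /eqP.
exists #|W|; first by apply/card_gt0P; exists y; apply/WP.
pose a (i : 'I_s.+2) : G := enum_val (cast_ord (esym cA) i).
have aA i : a i \in A by apply: enum_valP.
have a_inj : injective a by move=> i j /enum_val_inj/cast_ord_inj.
have Wi (j : 'I_#|W|) : [/\ enum_val j != c,
    {in A, forall x, enum_val j != inn x} & {in A, forall x, enum_val j != out x}].
  exact/WP/enum_valP.
apply: (@spider_iso _ _ _ c (inn \o a) (out \o a) enum_val) => /=.
- by move=> i j /inn_inj e; apply: a_inj; apply: e.
- by move=> i j /out_inj e; apply: a_inj; apply: e.
- exact: enum_val_inj.
- by move=> i; apply: out_c.
- by move=> i j; apply: inn_out.
- by move=> i j; rewrite eq_sym; case: (Wi j) => _ /(_ _ (aA i)).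
- by move=> i j; rewrite eq_sym; case: (Wi j) => _ _ /(_ _ (aA i)).
- rewrite -(cardsC X) leq_add2r cardsU1 -addnA leq_add ?leq_b1 //.
  by apply: leq_trans (leq_card_setU _ _) _; rewrite leq_add // -cA leq_imset_card.
- by move=> i; apply: c_inn.
- by move=> i; apply: c_out.
- by move=> i; apply: adj_io.
- by move=> j; case: (Wi j) => *; apply: c_leaf.
- move=> u v uv uc vc; have [x xA h] := only u v uv uc vc.
  exists (cast_ord cA (enum_rank_in xA x)).
  by rewrite /a cast_ordK enum_rankK_in.
Qed.

Lemma spider_of_private_neighbors (G : sgraph) (D : {set G}) (m : G -> G) :
  connected G -> dominating D -> private_neighbors D m -> 4 <= #|D| ->
  nu2 G < #|D| + 2 ->
  exists s t, [/\ 0 < t, s + 3 = #|D| & isomorphic G (T s t)].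
Proof.
move=> conn dD pm cD nu2D.
pose M := [set [set x; m x] | x in D].
have ME : M \subset edges G.
  by apply/subsetP => _ /imsetP[x xD ->]; apply: edgeP; case: (pm x xD).
have Mmatch v f g : f \in M -> g \in M -> v \in f -> v \in g -> f = g.
  move=> /imsetP[x xD ->] /imsetP[z zD ->] vx vz.
  by rewrite (private_pair_inj pm xD zD vx vz).
have cM : #|M| = #|D|.
  apply: card_in_imset => x z xD zD e.
  by apply: (private_pair_inj pm xD zD (v := x)); rewrite -?e !inE eqxx.
have no2 f1 f2 : f1 \in edges G :\: M -> f2 \in edges G :\: M -> f1 != f2 ->
    (forall v, v \in f1 -> v \in f2 -> forall e, e \in M -> v \notin e) -> False.
  move=> h1 h2 h12 h; have := matching_add2_leq_nu2 ME Mmatch h1 h2 h12 h.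
  by rewrite cM leqNgt nu2D.
pose F u v := adj u v && ([set u; v] \notin M).
have FE u v : F u v -> [set u; v] \in edges G :\: M.
  by case/andP => uv uvM; rewrite inE uvM edgeP.
have Fint a b u v : F a b -> F u v -> [|| a == u, a == v, b == u | b == v].
  move=> /FE ab /FE uv; apply: contraT => /norP[au /norP[av /norP[bu bv]]].
  exfalso; apply: (no2 _ _ ab uv).
    apply/eqP => e; have : a \in [set a; b] by rewrite !inE eqxx.
    by rewrite e !inE (negbTE au) (negbTE av).
  move=> w; rewrite !inE => /orP[] /eqP->.
    by rewrite (negbTE au) (negbTE av).
  by rewrite (negbTE bu) (negbTE bv).
have MP u v : adj u v -> ~~ F u v ->
    (u \in D /\ v = m u) \/ (v \in D /\ u = m v).
  rewrite /F => uv; rewrite uv negbK => /imsetP[x xD e].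
  have ux : u \in [set x; m x] by rewrite -e !inE eqxx.
  have vx : v \in [set x; m x] by rewrite -e !inE eqxx orbT.
  move: ux vx uv; rewrite !inE => /orP[]/eqP-> /orP[]/eqP->;
    rewrite ?adj_irrefl //; by [left | right].
(* An edge leaving the pair is not in [M], since pairs are disjoint. If no edge left it, the pair
   would be closed under adjacency and miss [z], against connectedness. *)
have touch x : x \in D -> exists u v, u \in [set x; m x] /\ F u v.
  move=> xD; pose S := [set x; m x].
  have [mxD _ _] := pm x xD.
  have [z zD zx] : exists2 z, z \in D & z != x.
    have /card_gt0P[z] : 0 < #|D :\ x|.
      by rewrite (cardsD1 x D) xD in cD; apply: leq_trans (_ : 3 <= _).
    by rewrite !inE => /andP[zx zD]; exists z.
  have zS : z \notin S.
    by rewrite !inE negb_or zx /=; apply: contraNneq mxD => <-.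
  have [/existsP[u /existsP[v /and3P[uS vS uv]]]|nS] :=
    boolP [exists u, exists v, [&& u \in S, v \notin S & adj u v]].
    exists u, v; split=> //; apply: contraT => /(MP _ _ uv)[[uD e]|[vD e]].
      have eux : u = x.
        by apply: (private_pair_inj pm uD xD (v := u)); rewrite // !inE eqxx.
      by rewrite e eux !inE eqxx orbT in vS.
    have evx : v = x 
      by apply: (private_pair_inj pm vD xD (v := u)); rewrite // e !inE eqxx orbT.
    by rewrite evx !inE eqxx in vS.
  have Scl : closed (@adj G) (mem S).
    apply: intro_closed; first exact: sym_connect_sym (@adj_sym G).
    move=> u v uv uS; apply: contraT => vS; case/negP: nS.
    by apply/existsP; exists u; apply/existsP; exists v; apply/and3P.
  by have := closed_connect Scl (conn x z); rewrite /= (negbTE zS) !inE eqxx.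
have Firr : irreflexive F by move=> x; rewrite /F adj_irrefl.
have [k kstar] := intersecting_star Firr Fint
  (fun x z v xD zD => @private_pair_inj G D m x z v pm xD zD) touch cD.
have Fsym u v : F u v = F v u by rewrite /F adj_sym setUC.
have leg x : x \in D -> k \notin [set x; m x] ->
    exists2 u, u \in [set x; m x] & F k u.
  move=> xD kx; have [u [v [ux uv]]] := touch x xD; exists u => //.
  by have [eu|<-] := kstar _ _ uv; [rewrite -eu ux in kx | rewrite Fsym].
(* If [M] missed [k], star edges to two different pairs would meet only in [k] and contradict
   [no2]. *)
have [x0 x0D kx0] : exists2 x, x \in D & k \in [set x; m x].
  have /card_gt1P[x [y [xD yD xy]]] : 1 < #|D| by apply: leq_trans cD.
  apply/exists_inP; apply: contraT => /exists_inPn nk; exfalso.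
  have [u ux /FE ku] := leg x xD (nk x xD).
  have [v vy /FE kv] := leg y yD (nk y yD).
  have uk : u != k by apply: contraTneq ux => ->; apply: nk.
  have uv : u != v.
    by apply: contraNneq xy => e; rewrite (private_pair_inj pm xD yD ux) // e.
  apply: (no2 _ _ ku kv).
    apply/eqP => e; have : u \in [set k; u] by rewrite !inE eqxx orbT.
    by rewrite e !inE (negbTE uk) (negbTE uv).
  move=> w; rewrite !inE => /orP[] /eqP->.
    by move=> _ f /imsetP[z zD ->]; apply: nk.
  by rewrite (negbTE uk) (negbTE uv).
have cA : #|D :\ x0|.+1 = #|D| by rewrite (cardsD1 x0 D) x0D.
have m_inj := private_neighbors_inj pm.
have m_injA : {in D :\ x0 &, injective m}.
  by move=> x y /setD1P[_ xD] /setD1P[_ yD]; apply: m_inj.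
have kA x : x \in D :\ x0 -> k \notin [set x; m x].
  move=> /setD1P[xx0 xD]; apply: contraNN xx0 => kx.
  by rewrite (private_pair_inj pm xD x0D kx).
have legA x : x \in D :\ x0 -> adj k x \/ adj k (m x).
  move=> xA; have [_ xD] := setD1P xA.
  have [u] := leg x xD (kA x xA); rewrite !inE => /orP[]/eqP-> /andP[]; by [left|right].
(* An edge avoiding [k] is not in the star, so it lies in [M] and is not the pair of [x0]. *)
have inter u v : adj u v -> u != k -> v != k -> exists2 x, x \in D :\ x0 &
    (u = x /\ v = m x) \/ (u = m x /\ v = x).
  move=> uv uk vk.
  have nF : ~~ F u v.
    by apply/negP => /kstar[] e; rewrite e eqxx in uk vk.
  have xx0 x : x \in D -> m x != k -> x != k -> x \in D :\ x0.
    move=> xD mxk xk; rewrite !inE xD andbT; apply: contraTneq kx0 => <-.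
    by rewrite !inE negb_or !(eq_sym k) xk mxk.
  have [[uD e]|[vD e]] := MP _ _ uv nF.
    by exists u; [apply: xx0; rewrite -?e | left].
  by exists v; [apply: xx0; rewrite -?e | right].
have mD x : x \in D :\ x0 -> m x \notin D by move=> /setD1P[_ /pm[]].
have pr x z : x \in D :\ x0 -> z \in D -> adj z (m x) -> z = x.
  by move=> /setD1P[_ /pm[_ _ p]]; apply: p.
have madj x : x \in D :\ x0 -> adj x (m x) by move=> /setD1P[_ /pm[]].
have neqA x : x \in D :\ x0 -> (x != k) && (m x != k).
  by move=> /kA; rewrite !inE negb_or !(eq_sym k).
(* All pairs but that of [x0] are legs, and two of them are arms of the path, so [s + 2] is
   [#|D| - 1]. *)
have [s cs] : exists s, #|D :\ x0| = s.+2.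
  by move: cD; rewrite -cA; case: #|_| => [|[|s]] // _; exists s.
suff [t t0 iso] : exists2 t, 0 < t & isomorphic G (T s t).
  by exists s, t; split=> //; rewrite -cA cs addn3.
have [mx0D adj0 pr0] := pm x0 x0D.
have DA x : x \in D -> x != x0 -> x \in D :\ x0 by move=> *; apply/setD1P.
move: kx0; rewrite !inE => /orP[] /eqP ek.
(* Case [k = x0]: as [k] is in [D], privateness forbids an edge from [k] to another [m x], so each
   [x] is inner and [m x0] is a leaf. *)
- apply: (@spider_iso_in _ (D :\ x0) k (m x0) id m) => //.
  + by move=> x /neqA/andP[].
  + move=> x z xA zA; apply: contraNneq (mD z zA) => <-.
    by case/setD1P: xA.
  + by rewrite ek eq_sym adj_neq.
  + by move=> x /setD1P[_ xD]; apply: contraNneq mx0D => ->.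
  + move=> x /setD1P[xx0 xD]; apply: contra xx0 => /eqP e.
    by apply/eqP/m_inj.
  + move=> x xA; have [//|kmx] := legA x xA.
    have := neqA x xA; rewrite (pr x k xA) ?eqxx //; last by rewrite ek.
  + move=> x xA; apply/negP => kmx.
    have := neqA x xA; rewrite (pr x k xA) ?eqxx //; last by rewrite ek.
  (* A remaining vertex is dominated by [k]: any other dominator would give an edge avoiding [k],
     hence a leg. *)
  + move=> v vk vi vo.
    have vD : v \notin D.
      by apply/negP => vD; have := vi v (DA v vD _); rewrite eqxx -ek => /(_ vk).
    have /dominatingP/(_ v vD)[u uD vu] := dD.
    have [euk|uk] := eqVneq u k; first by rewrite -euk adj_sym.
    have [x xA [[e _]|[e _]]] := inter v u vu vk uk.
      by have := vi x xA; rewrite e eqxx.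
    by have := vo x xA; rewrite e eqxx.
(* Case [k = m x0]: privateness of [k] leaves [x0] as its only neighbour in [D], so each [m x] is
   inner and [x0] is the only leaf. *)
- have nkx x : x \in D :\ x0 -> ~~ adj k x.
    move=> /setD1P[xx0 xD]; apply: contra xx0 => kx.
    by rewrite (pr0 x xD) // -ek adj_sym.
  apply: (@spider_iso_in _ (D :\ x0) k x0 m id) => //.
  + by move=> x /neqA/andP[].
  + move=> x z xA zA; apply: contraNneq (mD x xA) => ->.
    by case/setD1P: zA.
  + by rewrite ek adj_neq.
  + by move=> x xA; apply: contraNneq (mD x xA) => <-.
  + by move=> x /setD1P[]; rewrite eq_sym.
  + by move=> x xA; have [kx|//] := legA x xA; case/negP: (nkx x xA).
  + by move=> x xA; rewrite adj_sym madj.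
  + move=> v vk vi vo.
    have [->|vx0] := eqVneq v x0; first by rewrite ek adj_sym.
    have vD : v \notin D.
      by apply/negP => vD; have := vo v (DA v vD vx0); rewrite eqxx.
    have /dominatingP/(_ v vD)[u uD vu] := dD.
    have uk : u != k by apply: contraNneq mx0D => e; rewrite -ek -e.
    have [x xA [[e _]|[e _]]] := inter v u vu vk uk.
      by have := vo x xA; rewrite e eqxx.
    by have := vi x xA; rewrite e eqxx.
  + by move=> u v uv uk vk; have [x xA h] := inter u v uv uk vk; exists x; tauto.
Qed.

(** * The equivalence for connected graphs *)

Theorem theorem3p7 (G : sgraph) (hconn : connected G)
    (hE : nu2 G < #|edges G|) (hnu : 5 <= nu2 G) :
  gamma G = nu2 G - 1 <->
  exists s t : nat, [/\ 0 < s, 0 < t, s + 4 = nu2 G & isomorphic G (T s t)].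
Proof.
split=> [gE | [s [t [_ t0 nu2E iso]]]]; last first.
  by rewrite (gamma_iso iso) gamma_T // -nu2E addn4 addn3 subn1.
(* The truncated subtraction is genuine because [nu2 G] is positive. *)
have nu2E : nu2 G = (gamma G).+1 by rewrite gE subn1 prednK // (leq_trans _ hnu).
(* [hE] yields an edge, hence a vertex other than [x]; a path to it starts with a neighbour of
   [x]. *)
have noiso (x : G) : exists y, adj x y.
  have /card_gt0P[f0 /imsetP[[a b] + _]] := leq_ltn_trans (leq0n _) hE.
  rewrite inE /= => ab.
  have [z zx] : exists z, z != x.
    have [ax|] := eqVneq a x; last by exists a.
    by exists b; rewrite -ax eq_sym adj_neq.
  have /connectP[[|y p] /= xp ze] := hconn x z; first by rewrite ze eqxx in zx.
  by exists y; case/andP: xp.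
have [D [m [dD cD pm]]] := private_neighbors_exist noiso.
have [||s [t [t0 sE iso]]] := spider_of_private_neighbors hconn dD pm.
- by rewrite cD -ltnS -nu2E.
- by rewrite cD nu2E addn2.
exists s, t; split=> //; last by rewrite nu2E -cD -sE addn4 addn3.
(* [0 < s] is the bound [5 <= nu2 G] read through [nu2 G = s + 4]. *)
by move: hnu; rewrite nu2E -cD -sE addn3 !ltnS.
Qed.
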